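(* Let $\mathbf{k}$ be a field of characteristic zero, let $n\ge 1$ and $k\ge 2$ be integers. Let $\mathcal{A}'$ be the family of non-empty subsets $A\subseteq\{1,\dots,n\}$ satisfying $\max(A)=2|A|-k$, and let $\mathcal{A}$ be the family of inclusion-minimal members of $\mathcal{A}'$. Let $\prec$ be any term ordering on $\mathbf{k}[x_1,\dots,x_n]$ which, after some permutation of the first $k$ variables (of all the variables if $k>n$) and a suitable (possibly empty) set of transpositions of indices of the form $(k+2i-1,\,k+2i)$ with $i\ge 1$, $k+2i\le n$, satisfies $x_1\succ\cdots\succ x_n$; that is, there is a permutation $\pi$ of $\{1,\dots,n\}$, a product of a permutation of $\{1,\dots,\min(k,n)\}$ and some of these transpositions, such that $x_{\pi(1)}\succ x_{\pi(2)}\succ\cdots\succ x_{\pi(n)}$. Then the reduced Gröbner basis of $I_{n,k}=(x_1^2,\dots,x_n^2,(x_1+\cdots+x_n)^k)$ with respect to $\prec$ is $$G_{n,k}=\{x_1^2,\dots,x_n^2\}\cup\bigcup_{d=k}^{k+\lfloor (n-k)/2\rfloor}\{g_{A,n,k}\mid A\in\mathcal{A},\ |A|=d\},$$ where for $|A|=d$, $$g_{A,n,k}=e_d(x_{i_1},\dots,x_{i_{n-d+k}})$$ is the elementary symmetric polynomial of degree $d$ in the variables indexed by $\{i_1,\dots,i_{n-d+k}\}=A\cup\{2d-k+1,\dots,n\}$, with leading term $x_A=\prod_{a\in A}x_a$. In particular, $g_{A,n,k}$ is supported on $\binom{n-d+k}{d}$ terms. Moreover, for fixed $k$ the sequence of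 cardinalities $|\{A\in\mathcal{A}:|A|=d\}|$ is a $(k-1)$-fold convolution of the sequence of Catalan numbers, i.e. for every integer $r\ge 0$ with $k+2r\le n$, $|\{A\in\mathcal{A}:|A|=k+r\}|$ equals the coefficient of $t^r$ in $\left(\sum_{i\ge 0}C_it^i\right)^k$.
   Context: $C_i=\binom{2i}{i}-\binom{2i}{i-1}$ is the $i$-th Catalan number. The $m$-fold self-convolution of a sequence $(a_i)_{i\ge0}$ is the sequence of coefficients of the power series $\left(\sum_{i\ge 0} a_it^i\right)^{m+1}$. A Gröbner basis of an ideal $I$ is reduced if its leading monomials form the minimal generating set of the initial ideal of $I$ (bijectively), all leading coefficients are $1$, and no non-leading monomial of any of its elements lies in the initial ideal. A union over an empty index range is empty (this occurs for $k>n$). *)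

(* Defs.v *)
From HB Require Import structures.
From mathcomp Require Import all_boot all_order all_fingroup all_algebra.
From mathcomp Require Export mpoly.

Set Implicit Arguments.
Unset Strict Implicit.
Unset Printing Implicit Defensive.

Import GRing.Theory.
Local Open Scope ring_scope.

(* Throughout, the index a in {1, ..., n} is the ordinal i : 'I_n with
   i.+1 = a; 1-based formulas are written with i.+1. *)

Section Groebner.
Variables (n : nat) (K : fieldType).
Implicit Types (le : rel 'X_{1..n}) (p q : {mpoly K[n]}).

Definition ideal_gen (S : {mpoly K[n]} -> Prop) p : Prop :=
  exists s : seq ({mpoly K[n]} * {mpoly K[n]}),
    (forall c, c \in s -> S c.2) /\ p = \sum_(c <- s) c.1 * c.2.

Definition monomial_ideal (M : 'X_{1..n} -> Prop) : {mpoly K[n]} -> Prop :=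
  ideal_gen (fun q => exists2 m, M m & q = 'X_[m]).

(* le is the non-strict order on exponent vectors; (_ + _)%MM is the product of
   monomials and 0%MM is the monomial 1. *)
Definition term_order le : Prop :=
  [/\ [/\ reflexive le, antisymmetric le, transitive le & total le],
      forall m, le 0%MM m
    & forall m m1 m2, le m1 m2 -> le (m1 + m)%MM (m2 + m)%MM].

Definition term_lt le : rel 'X_{1..n} := [rel m1 m2 | (m1 != m2) && le m1 m2].

(* The library's mlead is tied to one fixed order; this is its analogue for an
   arbitrary one. The value at p = 0 is the dummy 0%MM. *)
Definition lead_mon le p : 'X_{1..n} :=
  \big[(fun m1 m2 => if le m1 m2 then m2 else m1)/0%MM]_(m <- msupp p) m.

Definition lead_coeff le p : K := p@_(lead_mon le p).

Definition lead_term le p : {mpoly K[n]} :=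
  lead_coeff le p *: 'X_[lead_mon le p].

Definition initial_ideal le (I : {mpoly K[n]} -> Prop) : {mpoly K[n]} -> Prop :=
  monomial_ideal (fun m => exists f, [/\ I f, f != 0 & m = lead_mon le f]).

Definition lead_mons le (G : seq {mpoly K[n]}) : 'X_{1..n} -> Prop :=
  fun m => exists2 g, g \in G & m = lead_mon le g.

(* The sequence G is used only through membership, as a finite set. *)
Definition groebner_basis le (I : {mpoly K[n]} -> Prop)
    (G : seq {mpoly K[n]}) : Prop :=
  (forall g, g \in G -> I g /\ g != 0) /\
  (forall p, initial_ideal le I p <-> monomial_ideal (lead_mons le G) p).

Definition minimal_monomial_generators (J : {mpoly K[n]} -> Prop)
    (M : 'X_{1..n} -> Prop) : Prop :=
  (forall p, J p <-> monomial_ideal M p) /\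
  (forall M' : 'X_{1..n} -> Prop,
     (forall m, M' m -> M m) -> (forall p, J p <-> monomial_ideal M' p) ->
     forall m, M m -> M' m).

Definition reduced_groebner_basis le (I : {mpoly K[n]} -> Prop)
    (G : seq {mpoly K[n]}) : Prop :=
  [/\ groebner_basis le I G,
      {in G &, injective (lead_mon le)} /\
        minimal_monomial_generators (initial_ideal le I) (lead_mons le G),
      forall g, g \in G -> lead_coeff le g = 1
    & forall g m, g \in G -> m \in msupp g -> m != lead_mon le g ->
        ~ initial_ideal le I 'X_[m]].

End Groebner.

Section Objects.
Variables (n : nat) (K : fieldType) (k : nat).

(* max(A) = 2|A| - k, stated without truncated subtraction. *)
Definition famA' : {set {set 'I_n}} :=
  [set A : {set 'I_n} |
    (A != set0) && (\max_(i in A) i.+1 + k == 2 * #|A|)%N].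

Definition famA : {set {set 'I_n}} :=
  [set A : {set 'I_n} | minset (fun B => B \in famA') A].

(* a in {2d-k+1, ..., n} is written 2d < a + k. *)
Definition gvars (A : {set 'I_n}) : {set 'I_n} :=
  A :|: [set i : 'I_n | 2 * #|A| < i.+1 + k]%N.

Definition gpoly (A : {set 'I_n}) : {mpoly K[n]} :=
  mesym #|gvars A| K #|A|
    \mPo [tuple 'X_(enum_val i) | i < #|gvars A|].

Definition ideal_I : {mpoly K[n]} -> Prop :=
  ideal_gen (fun q => (exists i : 'I_n, q = 'X_i ^+ 2) \/
                      q = (\sum_(i < n) 'X_i) ^+ k).

(* k, ..., k + floor((n-k)/2); for k > n the floor is negative and the range
   is empty, whereas (n - k)./2 truncates to 0. *)
Definition drange : seq nat :=
  if (k <= n)%N then iota k ((n - k)./2.+1) else [::].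

Definition basisG : seq {mpoly K[n]} :=
  [seq 'X_i ^+ 2 | i : 'I_n] ++
  flatten [seq [seq gpoly A | A in [set A in famA | #|A| == d]] | d <- drange].

(* t = (k+2i-1, k+2i) with i >= 1 and k+2i <= n (the latter because b : 'I_n). *)
Definition special_transposition (t : 'S_n) : Prop :=
  exists (i : nat) (a b : 'I_n),
    [/\ (1 <= i)%N, a.+1 = (k + 2 * i - 1)%N, b.+1 = (k + 2 * i)%N
      & t = tperm a b].

Definition admissible_perm (pi : 'S_n) : Prop :=
  exists (sigma : 'S_n) (T : {set 'S_n}),
    [/\ perm_on [set i : 'I_n | i < k]%N sigma,
        forall t, t \in T -> special_transposition t
      & pi = (sigma * \prod_(t in T) t)%g].

Definition admissible_order (le : rel 'X_{1..n}) : Prop :=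
  term_order le /\
  exists2 pi : 'S_n, admissible_perm pi
    & forall i j : 'I_n, (i < j)%N -> term_lt le U_(pi j)%MM U_(pi i)%MM.

End Objects.

(* The correction term is 0 for i = 0, where 'C(2 * i, i.-1) would give 1. *)
Definition catalan (i : nat) : nat :=
  ('C(2 * i, i) - (if i is j.+1 then 'C(2 * i, j) else 0))%N.

(* A formal power series is identified with its sequence of coefficients. *)
Definition series_one : nat -> nat := fun r => (r == 0)%N.
Definition series_mul (a b : nat -> nat) : nat -> nat :=
  fun r => (\sum_(i < r.+1) a i * b (r - i))%N.
Definition series_exp (a : nat -> nat) (m : nat) : nat -> nat :=
  iter m (series_mul a) series_one.

Definition self_convolution (m : nat) (a : nat -> nat) : nat -> nat :=
  series_exp a m.+1.

(* Main.v *)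
Require Import Defs.
From mathcomp Require Import all_boot all_order all_fingroup all_algebra.
From mathcomp Require Import mpoly.
From mathcomp Require Import zify.

(* Squarefree monomials of degree d, as subsets of {1, ..., n}, are +-1 walks of
   length n. A walk contains a member of [famA'] iff it reaches height k, and
   the minimal members are the walks stopped at their first visit to k, which a
   first-step recursion identifies with the k-fold convolution of the Catalan
   numbers.

   Modulo squares, [gpoly A] is up to a scalar the d-th power of the sum of its
   variables, that is of (x_1 + ... + x_n) - u, where u is a sum of d - k
   variables and hence u^(d-k+1) = 0; so [gpoly A] lies in the ideal. Its leading
   monomial is x_A because max A is the end of a block of variables preserved by
   an admissible permutation. Conversely, the squarefree degree-d parts of the
   ideal are spanned by the C(n, d-k) products of (x_1 + ... + x_n)^k with
   squarefree monomials, and by the reflection principle at least that many (or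
   all) squarefree monomials of degree d are divisible by some x_A. Thus there is
   no room for a further leading monomial: no Lefschetz property is needed. *)

Set Implicit Arguments.
Unset Strict Implicit.
Unset Printing Implicit Defensive.
Import GRing.Theory.

(** * Ballot numbers *)

(** Counts the walks with [r] down steps that first reach height [m] at their last step, number
    [m + 2 * r]. The case [r = 0] is set apart because the subtracted binomial would have lower
    index -1. *)
Definition ballot (m r : nat) : nat :=
  if r is s.+1 then 'C((m + 2 * r).-1, r) - 'C((m + 2 * r).-1, s) else 1.

Lemma leq_bin_half (N r : nat) : 2 * r < N -> 'C(N, r) <= 'C(N, r.+1).
Proof.
move=> rN; rewrite -(leq_pmul2l (ltn0Sn r)) mul_bin_left leq_mul2r.
by apply/orP; right; lia.
Qed.

(** Binomials increase up to the middle of a row, so the truncated subtraction is exact;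
    computations use this additive form. *)
Lemma ballotK (m r : nat) :
  ballot m r.+1 + 'C(m + 2 * r + 1, r) = 'C(m + 2 * r + 1, r.+1).
Proof.
rewrite /ballot; have -> : (m + 2 * r.+1).-1 = m + 2 * r + 1 by lia.
by rewrite subnK // leq_bin_half //; lia.
Qed.

Lemma ballot0n (r : nat) : ballot 0 r = (r == 0).
Proof.
case: r => [|r] //; have := ballotK 0 r.
(* The two middle binomials of an odd row coincide. *)
rewrite -(@bin_sub (0 + 2 * r + 1) r.+1); last by lia.
have -> : 0 + 2 * r + 1 - r.+1 = r by lia.
by rewrite -[RHS]add0n => /addIn ->.
Qed.

Lemma ballot1n (r : nat) : ballot 1 r = catalan r.
Proof.
case: r => [|r]; rewrite /ballot /catalan ?bin0 //.
Qed.

Lemma ballot_rec (m r : nat) :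
  ballot m.+1 r.+1 = ballot m r.+1 + ballot m.+2 r.
Proof.
have := ballotK m r; have := ballotK m.+1 r.
have -> : m.+1 + 2 * r + 1 = (m + 2 * r + 1).+1 by lia.
rewrite binS; case: r => [|r].
  have -> : ballot m.+2 0 = 1 by [].
  by rewrite !bin0; lia.
have := ballotK m.+2 r; have -> : m.+2 + 2 * r + 1 = m + 2 * r.+1 + 1 by lia.
by have := binS (m + 2 * r.+1 + 1) r; lia.
Qed.

(* Both sides satisfy the recursion of [ballot_rec], which for walks is the
   decomposition according to the first step. *)
Lemma ballot_conv (m r : nat) :
  \sum_(i < r.+1) ballot 1 i * ballot m (r - i) = ballot m.+1 r.
Proof.
elim: r m => [|r IHr] m; first by rewrite big_ord1.
elim: m => [|m IHm].
  rewrite (bigD1 ord_max) //= subnn muln1 big1 ?addn0 // => i.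
  move=> /eqP ne; rewrite ballot0n; case: eqP => [|]; last by rewrite muln0.
  by have := ltn_ord i; move=> *; case: ne; apply/val_inj => /=; lia.
rewrite ballot_rec -IHm -IHr [in RHS]big_ord_recr /= big_ord_recr /=.
(* The terms of index [r.+1] agree because [ballot _ 0] is 1; the others match one by one through
   [ballot_rec]. *)
rewrite subnn addnAC -big_split /=; congr (_ + _).
by apply: eq_bigr => i _; rewrite -mulnDr subSn -?ballot_rec // -ltnS.
Qed.

Lemma series_exp_catalan (m r : nat) : series_exp catalan m r = ballot m r.
Proof.
elim: m r => [|m IHm] r; first by rewrite ballot0n.
rewrite -ballot_conv; apply: eq_bigr => i _.
by rewrite ballot1n; congr (_ * _); exact: IHm.
Qed.

(** * Walks *)

Section Walks.
Variables (n k : nat).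
Implicit Types (S A B : {set 'I_n}) (s t d : nat).

Definition below t : {set 'I_n} := [set i : 'I_n | i < t].

(* [S] encodes the walk whose step at time [i] is +1 if [i \in S] and -1
   otherwise; its height at time [s] is [2 * #|S :&: below s| - s]. *)
Definition avoids t S : bool :=
  all (fun s => 2 * #|S :&: below s| < s + k) (iota 0 t.+1).

(** Walks of [t] steps, [d] of them up, that stay below height [k]. *)
Definition avoiders t d : {set {set 'I_n}} :=
  [set S : {set 'I_n} | [&& S \subset below t, #|S| == d & avoids t S]].

Lemma avoidsP t S :
  reflect (forall s, s <= t -> 2 * #|S :&: below s| < s + k) (avoids t S).
Proof.
apply: (iffP allP) => [av s st | av s]; first by apply: av; rewrite mem_iota.
by rewrite mem_iota add0n ltnS => /andP[_]; exact: av.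
Qed.

Lemma avoidsS t S :
  avoids t.+1 S = avoids t S && (2 * #|S :&: below t.+1| < t.+1 + k).
Proof. by rewrite /avoids -[in LHS](addn1 t.+1) iotaD all_cat /= andbT. Qed.

Lemma belowS (i : 'I_n) : below i.+1 = i |: below i.
Proof. by apply/setP => j; rewrite !inE ltnS leq_eqVlt. Qed.

Lemma sub_below t s : t <= s -> below t \subset below s.
Proof. by move=> ts; apply/subsetP => i; rewrite !inE => /leq_trans; apply. Qed.

Lemma below_full : below n = setT.
Proof. by apply/setP => i; rewrite !inE ltn_ord. Qed.

Lemma below0 : below 0 = set0.
Proof. by apply/setP => i; rewrite !inE. Qed.

Lemma card_below t : t <= n -> #|below t| = t.
Proof.
elim: t => [|t IH] tn; first by rewrite below0 cards0.
by rewrite (belowS (Ordinal tn)) cardsU1 inE ltnn (IH (ltnW tn)).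
Qed.

Lemma eq_avoids t S S' :
  S :&: below t = S' :&: below t -> avoids t S = avoids t S'.
Proof.
move=> eqS; apply/avoidsP/avoidsP => av s st; have := av s st;
by rewrite -(setIidPr (sub_below st)) !setIA eqS.
Qed.

(** The last step is down. Dropping it loses no condition, since the bound puts the final height
    below [k]. *)
Lemma avoiders_notin (i : 'I_n) d : 2 * d <= i + k ->
  avoiders i.+1 d :\: [set S : {set 'I_n} | i \in S] = avoiders i d.
Proof.
move=> dk; apply/setP => S; rewrite !inE avoidsS belowS.
apply/idP/idP.
  case/and4P => iS sS cS /andP[av _]; rewrite cS av !andbT /=.
  apply/subsetP => j jS; have := subsetP sS _ jS.
  by rewrite in_setU1 => /orP[/eqP ji|//]; rewrite -ji jS in iS.
case/and3P => sS cS av; rewrite cS av /= (subset_trans sS) ?subsetU1 //=.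
have iS : i \notin S by apply/negP => /(subsetP sS); rewrite inE ltnn.
rewrite iS setIUr setIC; have -> : [set i] :&: S = set0.
  by apply/disjoint_setI0; rewrite disjoints1.
by rewrite set0U (setIidPl sS) (eqP cS); lia.
Qed.

(** The last step is up; the bound again puts the final height below [k], so only the first [i]
    steps are constrained. *)
Lemma avoiders_in (i : 'I_n) d : 2 * d.+1 <= i + k ->
  avoiders i.+1 d.+1 :&: [set S : {set 'I_n} | i \in S] =
  [set i |: S | S in avoiders i d].
Proof.
move=> dk; apply/setP => S; apply/idP/imsetP.
  rewrite !inE => /andP[/and3P[sS cS]]; rewrite avoidsS => /andP[av _ iS].
  exists (S :\ i); last by rewrite setD1K.
  rewrite inE; apply/and3P; split.
  - apply/subsetP => j; rewrite !inE => /andP[ji /(subsetP sS)].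
    by rewrite belowS !inE (negPf ji).
  - by move: cS; rewrite (cardsD1 i) iS.
  - rewrite -(@eq_avoids _ S) //; apply/setP => j; rewrite !inE.
    by case: (j =P i) => [->|] //=; rewrite ltnn !andbF.
case=> S'; rewrite inE => /and3P[sS cS av] ->.
have iS : i \notin S' by apply/negP => /(subsetP sS); rewrite inE ltnn.
rewrite !inE eqxx /= andbT avoidsS cardsU1 iS (eqP cS) add1n eqxx /=.
rewrite belowS setUS //= (@eq_avoids i _ S') ?av /=; last first.
  apply/setP => j; rewrite !inE.
  by case: (j =P i) => [->|] //=; rewrite ltnn !andbF.
by rewrite -setUIr cardsU1 (setIidPl sS) iS (eqP cS); lia.
Qed.

Lemma setU1_avoiders_inj (i : 'I_n) d : {in avoiders i d &, injective (setU [set i])}.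
Proof.
have iS S : S \in avoiders i d -> i \notin S.
  rewrite inE => /and3P[sS _ _]; apply/negP => /(subsetP sS).
  by rewrite inE ltnn.
by move=> S S' /iS niS /iS niS' eqS; rewrite -(setU1K niS) eqS setU1K.
Qed.

(* André's reflection principle. *)
Lemma card_avoiders t d : 0 < k -> t <= n -> 2 * d <= t + k ->
  #|avoiders t d| + 'C(t, t + k - d) = 'C(t, d).
Proof.
move=> k0; elim: t d => [|t IH] d tn dk.
  have kd : 0 < 0 + k - d by lia.
  rewrite bin0n eqn0Ngt kd addn0 bin0n.
  have -> : avoiders 0 d = if d == 0 then [set set0] else set0.
    apply/setP => S; rewrite inE below0 subset0.
    case: (S =P set0) => [->|/eqP nS]; last by case: ifP; rewrite inE ?(negPf nS).
    rewrite cards0 eq_sym; case: (d == 0); rewrite !inE ?eqxx //=.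
    by rewrite /avoids /= set0I cards0 k0.
  by case: (d == 0); rewrite ?cards1 ?cards0.
pose i := Ordinal tn; have [|gt] := leqP (2 * d) (t + k); last first.
  (* All walks end at height [k]: none avoids it, and the two binomials are equal. *)
  have dE : 2 * d = t.+1 + k by lia.
  have -> : t.+1 + k - d = d by lia.
  rewrite [X in #|pred_of_set X|](_ : _ = set0) ?cards0 //.
  apply/setP => S; rewrite !inE; apply/negP => /and3P[sS /eqP cS].
  by rewrite avoidsS (setIidPl sS) cS dE ltnn andbF.
(* Split by the last step; the binomials split accordingly by Pascal's rule. *)
move=> dk'; rewrite -(cardsID [set S : {set 'I_n} | i \in S]).
rewrite (@avoiders_notin i) //; have tn' := ltnW tn.
case: d dk dk' => [|d] dk dk'.
  rewrite [X in #|pred_of_set X|](_ : _ = set0) ?cards0; last first.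
    apply/setP => S; rewrite !inE; apply/negP => /andP[/and3P[_]].
    by rewrite cards_eq0 => /eqP ->; rewrite inE.
  have := IH 0 tn' dk'; rewrite !bin0 !bin_small //; lia.
rewrite (@avoiders_in i) // (card_in_imset (@setU1_avoiders_inj i d)) /=.
have IH1 := IH _ tn' dk'; have IH2 : 2 * d <= t + k by lia.
have {}IH2 := IH d tn' IH2.
have -> : t.+1 + k - d.+1 = (t + k - d.+1).+1 by lia.
have E : t + k - d = (t + k - d.+1).+1 by lia.
by rewrite E in IH2; rewrite !binS /= -IH1 -IH2 addnACA addnC.
Qed.

(** * The families of the theorem as walks reaching height [k] *)

Lemma famA'_max A : A \in famA' n k ->
  exists2 i : 'I_n, i \in A & [/\ i.+1 + k = 2 * #|A|, A \subset below i.+1 &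
     forall j, j \in A -> j <= i].
Proof.
rewrite inE => /andP[A0 /eqP mA].
have /(eq_bigmax_cond (fun i : 'I_n => i.+1)) [i iA mi] : 0 < #|A|.
  by rewrite card_gt0.
have le j : j \in A -> j <= i.
  move=> jA; rewrite -ltnS -mi.
  exact: (@leq_bigmax_cond _ (mem A) (fun i : 'I_n => i.+1)).
exists i => //; split => //; first by rewrite -mi.
by apply/subsetP => j /le; rewrite inE ltnS.
Qed.

Lemma famA'I (i : 'I_n) A : i \in A -> i.+1 + k = 2 * #|A| ->
  A \subset below i.+1 -> A \in famA' n k.
Proof.
move=> iA cA sA; rewrite inE; apply/andP; split; first by apply/set0Pn; exists i.
rewrite -cA eqn_add2r eqn_leq.
rewrite (@leq_bigmax_cond _ (mem A) (fun i : 'I_n => i.+1)) // andbT.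
by apply/bigmax_leqP => j /(subsetP sA); rewrite inE.
Qed.

(** Cut the walk at its first visit to height [k]. As steps have size one, [k] is hit exactly and by
    an up step, so the up steps made so far form a member of [famA']. *)
Lemma not_avoids_famA' S t : 0 < k -> t <= n -> ~~ avoids t S ->
  exists2 A, A \in famA' n k & A \subset S :&: below t.
Proof.
move=> k0 tn; elim: t tn => [|t IH] tn.
  by rewrite /avoids /= below0 setI0 cards0 k0.
rewrite avoidsS; have [av /=|nav _] := boolP (avoids t S); last first.
  have [A fA sA] := IH (ltnW tn) nav; exists A => //.
  exact: subset_trans sA (setIS _ (sub_below (leqnSn t))).
rewrite -leqNgt => ge; have lt := avoidsP _ _ av _ (leqnn t).
pose i := Ordinal tn; have iB : below t.+1 = i |: below t by rewrite -belowS.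
have iS : i \in S.
  apply/negPn/negP => iS; move: ge; rewrite iB setIUr.
  have -> : S :&: [set i] = set0.
    by apply/disjoint_setI0; rewrite disjoint_sym disjoints1.
  by rewrite set0U => ge; have := leq_ltn_trans ge lt; rewrite addSn ltnNge leqnSn.
exists (S :&: below t.+1) => //; apply: (@famA'I i); rewrite ?subsetIr //.
  by rewrite !inE iS /=.
have : #|S :&: below t.+1| <= #|S :&: below t|.+1.
  rewrite iB setIUr; apply: leq_trans (leq_card_setU _ _) _.
  by rewrite -add1n leq_add2r -(cards1 i) subset_leq_card ?subsetIr.
by move: ge lt => /=; lia.
Qed.

(** At time max A the walk [S] is at least as high as the walk [A], which is then at [k]. *)
Lemma famA'_not_avoids A S t : A \in famA' n k -> A \subset S ->
  A \subset below t -> ~~ avoids t S.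
Proof.
move=> /famA'_max[i iA [cA sA _]] AS At; apply/negP => /avoidsP av.
have it : i < t by have := subsetP At _ iA; rewrite inE.
have : #|A| <= #|S :&: below i.+1| by rewrite subset_leq_card // subsetI AS.
by have := av _ it; lia.
Qed.

Lemma famA_sub_famA' A : A \in famA n k -> A \in famA' n k.
Proof. by rewrite inE => /minsetP[]. Qed.

Lemma famA'_famA A : A \in famA' n k -> exists2 B, B \in famA n k & B \subset A.
Proof.
by move=> /(@minset_exists _ (fun B => B \in famA' n k))[B mB sB];
  exists B; rewrite ?inE.
Qed.

Lemma famA_antichain A B : A \in famA n k -> B \in famA n k -> B \subset A -> B = A.
Proof. by rewrite inE => /minsetP[_ mA] /famA_sub_famA'; exact: mA. Qed.

(* A minimal member of [famA'] is a walk that reaches height [k] for the first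
   time at its last step. *)
Lemma famA_avoiders (i : 'I_n) d : 0 < k -> i.+1 + k = 2 * d.+1 ->
  [set A in famA n k | #|A| == d.+1] = [set i |: S | S in avoiders i d].
Proof.
move=> k0 iE; apply/setP => A; rewrite in_set; apply/andP/imsetP.
  case=> fA /eqP cA; have [j jA [jE sA _]] := famA'_max (famA_sub_famA' fA).
  have ij : j = i by apply/val_inj => /=; lia.
  rewrite {}ij {jE} in jA sA; exists (A :\ i); last by rewrite setD1K.
  have sA' : A :\ i \subset below i.
    apply/subsetP => l; rewrite !inE => /andP[li /(subsetP sA)].
    by rewrite belowS !inE (negPf li).
  rewrite inE sA' /=; apply/andP; split.
    by move: cA; rewrite (cardsD1 i) jA add1n => -[->].
  (* An earlier visit to [k] would give a minimal member inside [A :\ i]; the antichain property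
     makes it [A], which contains [i]. *)
  apply/negPn/negP => /(not_avoids_famA' k0 (ltnW (ltn_ord i)))[B fB].
  rewrite subsetI => /andP[BA _]; have [C fC CB] := famA'_famA fB.
  have CA : C = A.
    apply: famA_antichain => //; apply: subset_trans CB (subset_trans BA _).
    exact: subsetDl.
  have iC : i \in C by rewrite CA.
  by have := subsetP BA _ (subsetP CB _ iC); rewrite !inE eqxx.
case=> S; rewrite inE => /and3P[sS /eqP cS av] ->.
have iS : i \notin S by apply/negP => /(subsetP sS); rewrite inE ltnn.
have cA : #|i |: S| = d.+1 by rewrite cardsU1 iS cS.
rewrite cA eqxx; split=> //; rewrite inE; apply/minsetP; split.
  apply: (@famA'I i); rewrite ?setU11 ?cA //.
  by rewrite belowS setUS.
(* A smaller member has a smaller maximum, and would make [S] reach height [k] by time [i]. *)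
move=> B fB sB; apply/eqP; rewrite eqEcard sB /= cA leqNgt; apply/negP => lt.
have [j jB [jE Bj _]] := famA'_max fB.
have ji : 2 * #|B| < 2 * d.+1 by rewrite ltn_pmul2l.
have {}ji : j < i by rewrite -jE -iE in ji; lia.
have Bi := subset_trans Bj (sub_below ji).
move/negP: (famA'_not_avoids fB sB Bi); case.
rewrite (@eq_avoids i _ S) //; apply/setP => l; rewrite !inE.
by case: (l =P i) => [->|] //=; rewrite ltnn !andbF.
Qed.

(** Removing the final up step leaves a walk of [k + 2 * r - 1] steps, [k + r - 1] of them up;
    reflection counts these, and the symmetry of binomials gives [ballot]. *)
Lemma card_famA r : 0 < k -> k + 2 * r <= n ->
  #|[set A in famA n k | #|A| == (k + r)%N]| = ballot k r.
Proof.
move=> k0 kn; have lt : (k + 2 * r).-1 < n by lia.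
pose i := Ordinal lt; have [d dE] : exists d, k + r = d.+1.
  by exists (k + r).-1; lia.
rewrite dE (@famA_avoiders i) //=; last by lia.
rewrite (card_in_imset (@setU1_avoiders_inj i d)).
have dk : 2 * d <= i + k by rewrite /=; lia.
have iE : (i : nat) = (k + 2 * r).-1 by [].
have := card_avoiders k0 (ltnW (ltn_ord i)) dk; move: i iE dk => i iE dk.
have <- : 'C(i, r) = 'C(i, d).
  by rewrite -(@bin_sub _ d); [congr 'C(_, _)|]; lia.
(* Without down steps the reflected binomial is zero, in accordance with the separate value of
   [ballot]. *)
case: r {kn lt} iE dE => [|r] iE dE.
  by rewrite bin0 bin_small ?addn0 => [->|] //; lia.
have <- : 'C(i, r) = 'C(i, i + k - d).
  by rewrite -(@bin_sub _ r); [congr 'C(_, _)|]; lia.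
by rewrite /ballot -iE => <-; rewrite addnK.
Qed.

End Walks.

Local Open Scope ring_scope.

(** * Triangular families, monomial ideals and leading monomials *)

(** The matrix [F] factors through [E], so its rank is at most [#|E|]; being triangular with nonzero
    diagonal, it has rank [#|D|]. *)
Lemma card_triangular_le (K : fieldType) (T U : finType) (le : rel T)
    (D : {set T}) (E : {set U}) (F : T -> T -> K) (a : T -> U -> K)
    (b : U -> T -> K) :
  reflexive le -> antisymmetric le -> transitive le -> total le ->
  {in D &, forall x y, F x y = \sum_(u in E) a x u * b u y} ->
  {in D, forall x, F x x != 0} ->
  {in D &, forall x y, F x y != 0 -> le y x} ->
  (#|D| <= #|E|)%N.
Proof.
move=> le_refl le_anti le_trans le_total Fab F0 Fle.
pose A := \matrix_(i < #|D|, u < #|E|) a (enum_val i) (enum_val u).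
pose B := \matrix_(u < #|E|, j < #|D|) b (enum_val u) (enum_val j).
have ABE i j : (A *m B) i j = F (enum_val i) (enum_val j).
  rewrite mxE Fab ?enum_valP // [RHS]big_enum_val /=.
  by apply: eq_bigr => u _; rewrite !mxE.
suff /eqP <- : row_free (A *m B) by exact: mulmx_max_rank.
apply: inj_row_free => v vAB; apply/rowP => i0; rewrite mxE.
apply/eqP/negPn/negP => v0.
(* Take the [le]-largest index in the support of [v]: in its column only the diagonal entry
   contributes. *)
have [i vi maxi] := @extremumP _ _ (fun x y => le y x) i0
  (fun i => v 0 i != 0) (fun i => enum_val i) le_refl
  (fun y x z xy yz => le_trans _ _ _ yz xy) (fun x y => le_total y x) v0.
have := congr1 (fun w : 'rV_#|D| => w 0 i) vAB; rewrite !mxE (bigD1 i) //=.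
rewrite big1 ?addr0 => [/eqP|j ji].
  by rewrite mulf_eq0 (negPf vi) /= ABE (negPf (F0 _ (enum_valP i))).
have [->|vj] := eqVneq (v 0 j) 0; first by rewrite mul0r.
rewrite ABE; have [->|Fji] := eqVneq (F (enum_val j) (enum_val i)) 0.
  by rewrite mulr0.
have lij := Fle _ _ (enum_valP j) (enum_valP i) Fji.
have /enum_val_inj ij : enum_val j = enum_val i.
  by apply: le_anti; rewrite lij (maxi j vj).
by rewrite ij eqxx in ji.
Qed.

Section Ideals.
Variables (n : nat) (K : fieldType).
Implicit Types (p q : {mpoly K[n]}) (m : 'X_{1..n}) (S : {mpoly K[n]} -> Prop).

Lemma ideal_gen0 S : ideal_gen S 0.
Proof. by exists [::]; rewrite big_nil. Qed.

Lemma ideal_genD S p q : ideal_gen S p -> ideal_gen S q -> ideal_gen S (p + q).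
Proof.
case=> s [Ss ->] [t [St ->]]; exists (s ++ t); rewrite big_cat; split=> // c.
by rewrite mem_cat => /orP[/Ss|/St].
Qed.

Lemma ideal_genM S p q : ideal_gen S q -> ideal_gen S (p * q).
Proof.
case=> s [Ss ->]; exists [seq (p * c.1, c.2) | c <- s]; split.
  by move=> c /mapP[c' /Ss Sc ->].
by rewrite big_map mulr_sumr; apply: eq_bigr => c _; rewrite mulrA.
Qed.

Lemma ideal_genMr S p q : ideal_gen S p -> ideal_gen S (p * q).
Proof. by rewrite mulrC; exact: ideal_genM. Qed.

Lemma ideal_genN S p : ideal_gen S p -> ideal_gen S (- p).
Proof. by rewrite -mulN1r; exact: ideal_genM. Qed.

Lemma ideal_gen_in S p : S p -> ideal_gen S p.
Proof.
move=> Sp; exists [:: (1, p)]; rewrite big_seq1 mul1r; split=> // c.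
by rewrite inE => /eqP ->.
Qed.

Lemma ideal_gen_sum S (I : eqType) (r : seq I) (P : pred I) (F : I -> {mpoly K[n]}) :
  {in r, forall i, P i -> ideal_gen S (F i)} -> ideal_gen S (\sum_(i <- r | P i) F i).
Proof.
move=> SF; rewrite big_seq_cond; apply: big_ind.
- exact: ideal_gen0.
- by move=> p q; exact: ideal_genD.
- by move=> i /andP[]; exact: SF.
Qed.

Lemma mcoeffMX_eq0 p m m' : ~~ (m' <= m)%MM -> (p * 'X_[m'])@_m = 0.
Proof.
move=> nle; apply/eqP; rewrite mcoeff_eq0.
apply: contraNN nle => /msuppM_le /allpairsP[[m1 m2] /= [_]].
by rewrite msuppX inE => /eqP -> ->; exact: lem_addl.
Qed.

Lemma monomial_idealP (M : 'X_{1..n} -> Prop) p :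
  monomial_ideal M p <->
  (forall m, m \in msupp p -> exists2 m', M m' & (m' <= m)%MM).
Proof.
split=> [[s [Ms ->]] m | Mp].
  rewrite mcoeff_msupp raddf_sum /= => /eqP nz.
  have [c cs] : exists2 c, c \in s & (c.1 * c.2)@_m != 0.
    apply/hasP; apply/negPn/negP => /hasPn z; case: nz.
    by apply: big1_seq => c /andP[_ /z]; rewrite negbK => /eqP.
  have [m' Mm' ->] := Ms _ cs.
  have [m'm _|nle] := boolP (m' <= m)%MM; first by exists m'.
  by rewrite mcoeffMX_eq0 ?eqxx.
rewrite (mpolyE p); apply: ideal_gen_sum => m /Mp[m' Mm' m'm] _.
rewrite -(submK m'm) mpolyXD -mul_mpolyC; do 2 apply: ideal_genM.
by apply: ideal_gen_in; exists m'.
Qed.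

Lemma monomial_idealX (M : 'X_{1..n} -> Prop) m :
  monomial_ideal M ('X_[m] : {mpoly K[n]}) <-> exists2 m', M m' & (m' <= m)%MM.
Proof.
rewrite monomial_idealP; split=> [|H m']; last by rewrite msuppX inE => /eqP ->.
by apply; rewrite msuppX inE.
Qed.

Lemma eq_monomial_ideal (M M' : 'X_{1..n} -> Prop) :
  (forall m, M m -> exists2 m', M' m' & (m' <= m)%MM) ->
  (forall m, M' m -> exists2 m', M m' & (m' <= m)%MM) ->
  forall p, monomial_ideal M p <-> monomial_ideal M' p.
Proof.
move=> MM' M'M p; rewrite !monomial_idealP.
by split=> H m /H[m' /[dup] mm' +  le]; [move/MM'|move/M'M] => -[m'' Mm'' le'];
  exists m'' => //; apply: lepm_trans le' le.
Qed.

Variable le : rel 'X_{1..n}.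
Hypothesis leT : term_order le.

Lemma lead_mon_unique p m :
  m \in msupp p -> {in msupp p, forall m', le m' m} -> lead_mon le p = m.
Proof.
case: leT => -[le_refl le_anti _ le_total] le0 _.
rewrite /lead_mon => mp max; pose mx m1 m2 := if le m1 m2 then m2 else m1.
(* Tails of the list may lack [m], hence the second conjunct. The initial value [0%MM] does no harm,
   being the least monomial. *)
suff main : forall s : seq 'X_{1..n}, {in s, forall m', le m' m} ->
    (m \in s -> \big[mx/0%MM]_(x <- s) x = m) /\
    le (\big[mx/0%MM]_(x <- s) x) m.
  by have [-> //] := main _ max.
elim=> [|x s IH] lem; first by rewrite big_nil.
have [y ys|IH1 IH2] := IH; first by apply: lem; rewrite inE ys orbT.
have lx : le x m by apply: lem; rewrite mem_head.
rewrite big_cons inE {1 3}/mx; split; last by case: ifP.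
case: ifP => l; case: (m =P x) => [mE|_] //= ms.
- by apply: le_anti; rewrite IH2 mE l.
- by rewrite IH1 // lx in l.
Qed.

Lemma lead_monP p : p != 0 ->
  lead_mon le p \in msupp p /\ {in msupp p, forall m, le m (lead_mon le p)}.
Proof.
case: leT => -[le_refl le_anti le_trans le_total] _ _.
move=> p0; suff [m mp max] : exists2 m, m \in msupp p & {in msupp p, forall m', le m' m}.
  by rewrite (lead_mon_unique mp max).
have : msupp p != [::] by rewrite msupp_eq0.
elim: (msupp p) => // x [|y s] IH _.
  by exists x; rewrite ?mem_head // => m'; rewrite inE => /eqP ->.
have [//|m ms max] := IH; have [xm|mx] := orP (le_total x m).
  exists m; first by rewrite inE ms orbT.
  by move=> m'; rewrite inE => /orP[/eqP ->|/max].
exists x; first by rewrite mem_head.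
by move=> m'; rewrite inE => /orP[/eqP ->|/max h] //; apply: le_trans h mx.
Qed.

End Ideals.

(** * Elementary symmetric polynomials modulo squares *)

Section ElementarySymmetric.
Variables (n : nat) (K : fieldType).
Implicit Types (A B V : {set 'I_n}) (d : nat) (m : 'X_{1..n}).

Definition sqfree_mon B : {mpoly K[n]} := 'X_[mesym1 B].

(** The elementary symmetric polynomial in the variables of [V], written directly in the ring of all
    [n] variables. *)
Definition esym_on V d : {mpoly K[n]} :=
  \sum_(B : {set 'I_n} | (B \subset V) && (#|B| == d)) sqfree_mon B.

Lemma sqfree_monE B : sqfree_mon B = \prod_(i in B) 'X_i.
Proof.
rewrite /sqfree_mon mpolyXE_id [RHS]big_mkcond /=; apply: eq_bigr => i _.
by rewrite mnmE; case: (i \in B).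
Qed.

Lemma sqfree_monU1 i B : i \notin B -> sqfree_mon (i |: B) = 'X_i * sqfree_mon B.
Proof. by move=> iB; rewrite !sqfree_monE big_setU1. Qed.

Lemma mesym_comp_enum V d :
  mesym #|V| K d \mPo [tuple 'X_(enum_val i) | i < #|V|] = esym_on V d.
Proof.
rewrite mesymE raddf_sum /=.
transitivity (\sum_(h : {set 'I_#|V|} | #|h| == d) sqfree_mon (enum_val @: h)).
  apply: eq_bigr => h _; rewrite comp_mpolyX sqfree_monE.
  rewrite (big_imset (fun i => 'X_i)) /=; last by move=> i j _ _ /enum_val_inj.
  rewrite [RHS]big_mkcond /=; apply: eq_bigr => i _.
  by rewrite tnth_mktuple mnmE; case: (i \in h).
rewrite -(big_imset sqfree_mon) /=; last first.
  by move=> h h' _ _; apply: imset_inj; exact: enum_val_inj.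
apply: eq_bigl => B; apply/imsetP/andP => [[h /eqP hd ->]|[BV /eqP Bd]].
  rewrite card_imset ?hd //; last exact: enum_val_inj.
  by split=> //; apply/subsetP => _ /imsetP[i _ ->]; exact: enum_valP.
have BE : B = enum_val @: [set i : 'I_#|V| | enum_val i \in B].
  apply/setP => i; apply/idP/imsetP => [iB|[j]]; last by rewrite inE => jB ->.
  have iV := subsetP BV i iB; exists (enum_rank_in iV i); last first.
    by rewrite enum_rankK_in.
  by rewrite inE enum_rankK_in.
exists [set i : 'I_#|V| | enum_val i \in B] => //.
by apply/eqP; rewrite -Bd [in RHS]BE card_imset //; exact: enum_val_inj.
Qed.

Lemma mcoeff_esym_on V d B :
  (esym_on V d)@_(mesym1 B) = ((B \subset V) && (#|B| == d))%:R.
Proof.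
rewrite /esym_on raddf_sum /= big_mkcond (bigD1 B) //= big1 ?addr0 => [|C CB].
  by rewrite /sqfree_mon mcoeffX eqxx; case: ifP.
rewrite /sqfree_mon mcoeffX (inj_eq (@inj_mesym1 n)) (negPf CB); by case: ifP.
Qed.

Lemma msupp_esym_onP V d m :
  reflect (exists2 B : {set 'I_n}, (B \subset V) && (#|B| == d) & m = mesym1 B)
    (m \in msupp (esym_on V d)).
Proof.
apply: (iffP idP) => [|[B BV ->]]; last first.
  by rewrite mcoeff_msupp mcoeff_esym_on BV oner_eq0.
rewrite mcoeff_msupp raddf_sum /= => nz.
have /existsP[B /andP[BV /eqP mB]] :
    [exists B : {set 'I_n}, ((B \subset V) && (#|B| == d)) && (mesym1 B == m)].
  apply: contraNT nz => /existsPn z; apply/eqP/big1 => B BV.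
  by have := z B; rewrite BV /sqfree_mon mcoeffX /= => /negPf ->.
by exists B.
Qed.

Lemma size_msupp_esym_on V d : size (msupp (esym_on V d)) = 'C(#|V|, d).
Proof.
rewrite -cards_draws cardE -(size_map (@mesym1 n)); apply: perm_size.
apply: uniq_perm; first exact: msupp_uniq.
  by rewrite map_inj_uniq ?enum_uniq //; exact: inj_mesym1.
move=> m; apply/msupp_esym_onP/mapP => [[B BV ->]|[B]].
  by exists B; rewrite // mem_enum inE.
by rewrite mem_enum inE => BV ->; exists B.
Qed.

Section ModSquares.
Variable S : {mpoly K[n]} -> Prop.
Hypothesis sqS : forall i : 'I_n, S ('X_i ^+ 2).

(** In the product, a term with [i] in [B] contains a square, and each [d.+1]-subset of [V] arises
    once for each of its elements. *)
Lemma sum_mul_esym_on V d :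
  ideal_gen S ((\sum_(i in V) 'X_i) * esym_on V d - esym_on V d.+1 *+ d.+1).
Proof.
have -> : esym_on V d.+1 *+ d.+1 = \sum_(i in V) \sum_(B : {set 'I_n} |
    [&& B \subset V, #|B| == d & i \notin B]) 'X_i * sqfree_mon B.
  rewrite /esym_on -sumrMnl.
  transitivity (\sum_(B : {set 'I_n} | (B \subset V) && (#|B| == d.+1))
      \sum_(i in V | i \in B) sqfree_mon B).
    apply: eq_bigr => B /andP[BV /eqP Bd]; rewrite -Bd -sumr_const.
    by apply: eq_bigl => i; case iB: (i \in B); rewrite ?andbF // (subsetP BV).
  rewrite (exchange_big_dep (mem V)) /=; last by move=> B i _ /andP[].
  apply: eq_bigr => i iV.
  rewrite (reindex_onto (fun B => i |: B) (fun B => B :\ i)) /=; last first.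
    by move=> B /and3P[_ _ iB]; rewrite setD1K.
  apply: congr_big => // B; last by case/andP => _ /eqP <-; rewrite sqfree_monU1 ?setD11.
  rewrite iV setU11 !andbT subUset sub1set iV /= cardsU1.
  have -> : ((i |: B) :\ i == B) = (i \notin B).
    apply/eqP/idP => [<-|]; first by rewrite setD11.
    by move=> iB; rewrite setU1K.
  by case: (i \in B); rewrite ?andbF //= add1n eqSS !andbT.
rewrite mulr_suml -sumrB; apply: ideal_gen_sum => i _ iV.
rewrite mulr_sumr (bigID (fun B => i \notin B)) /= addrAC.
set s := \sum_(B | _) _; set t := \sum_(B | _) _; set u := \sum_(B | _) _.
have -> : s = t by apply: eq_bigl => B; rewrite andbA.
rewrite subrr add0r; apply: ideal_gen_sum => B _ /andP[_]; rewrite negbK => iB.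
rewrite -(setD1K iB) sqfree_monU1 ?setD11 // mulrA -expr2.
by apply: ideal_genMr; apply: ideal_gen_in.
Qed.

(** Modulo squares the multinomial expansion keeps only products of distinct variables, each with
    the factorial of [d] as coefficient. *)
Lemma sum_exp_esym_on V d :
  ideal_gen S ((\sum_(i in V) 'X_i) ^+ d - esym_on V d *+ d`!).
Proof.
elim: d => [|d IH].
  suff -> : esym_on V 0 = 1 by rewrite subrr; exact: ideal_gen0.
  rewrite /esym_on (big_pred1 set0) => [|B]; first by rewrite sqfree_monE big_set0.
  by rewrite cards_eq0 /=; case: eqP => [->|]; rewrite ?sub0set ?andbF.
set v := \sum_(i in V) _.
have -> : v ^+ d.+1 - esym_on V d.+1 *+ d.+1`! = v * (v ^+ d - esym_on V d *+ d`!)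
    + (v * esym_on V d - esym_on V d.+1 *+ d.+1) *+ d`!.
  rewrite exprS factS mulrnA mulrBr mulrnBl mulrnAr addrA subrK; congr (_ - _).
apply: ideal_genD; first exact: ideal_genM.
by rewrite -mulr_natl; apply: ideal_genM; exact: sum_mul_esym_on.
Qed.

(* With [l], [u], [v] the sums of all variables, of those outside [V] and of
   those in [V], expand [v ^+ d = (l - u) ^+ d]: modulo squares [u] is
   nilpotent of order [#|~: V|.+1], hence every surviving term contains
   [l ^+ k]; and [v ^+ d] is [d`!] times [esym_on V d]. *)
Lemma esym_on_ideal k V d : [pchar K] =i pred0 ->
  S ((\sum_(i < n) 'X_i) ^+ k) -> (#|~: V| + k = d)%N ->
  ideal_gen S (esym_on V d).
Proof.
move=> /pcharf0P charK Sl cV.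
have vE : \sum_(i in V) 'X_i =
    \sum_(i < n) 'X_i - \sum_(i in ~: V) 'X_i :> {mpoly K[n]}.
  rewrite [X in _ = X - _](bigID (mem V)) /=.
  by rewrite [X in _ - X](eq_bigl (fun i => i \notin V)) ?addrK // => i; rewrite inE.
(* In characteristic zero the factorial of [d] is invertible. *)
have dfact : esym_on V d = ((d`!%:R)^-1)%:MP * (esym_on V d *+ d`!).
  rewrite mulrnAr -mulrnAl -(raddfMn (@mpolyC n K)) /=.
  rewrite -[X in X%:MP]mulr_natr mulVf ?mul1r //.
  by rewrite charK -lt0n fact_gt0.
rewrite dfact; apply: ideal_genM.
have -> : esym_on V d *+ d`! = (\sum_(i in V) 'X_i) ^+ d
    - ((\sum_(i in V) 'X_i) ^+ d - esym_on V d *+ d`!) by rewrite subKr.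
apply: ideal_genD; last by apply: ideal_genN; exact: sum_exp_esym_on.
rewrite vE exprBn; apply: ideal_gen_sum => j _ _.
rewrite -mulr_natl; apply: ideal_genM; rewrite -mulrA; apply: ideal_genM.
(* For [j] at most [#|~: V|] the exponent [d - j] is at least [k]. Otherwise a power of the outer
   sum beyond the number of its variables appears, which lies in the ideal of squares. *)
have [jV|Vj] := leqP j #|~: V|.
  apply: ideal_genMr; have -> : (d - j = k + (#|~: V| - j))%N by lia.
  by rewrite exprD; apply: ideal_genMr; exact: ideal_gen_in.
apply: ideal_genM; rewrite -(subnK Vj) exprD; apply: ideal_genM.
have := sum_exp_esym_on (~: V) #|~: V|.+1.
rewrite [esym_on _ _]big1 ?mul0rn ?subr0 // => B /andP[BV /eqP cB].
by have := subset_leq_card BV; rewrite cB ltnn.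
Qed.

End ModSquares.
End ElementarySymmetric.

(** * Leading monomials of the ideal *)

Section SquarefreeMonomials.
Variable n : nat.
Implicit Types (A B : {set 'I_n}) (m : 'X_{1..n}).

Lemma mesym1_le A B : (mesym1 A <= mesym1 B)%MM = (A \subset B).
Proof.
apply/mnm_lepP/subsetP => [le i iA | AB i].
  by have := le i; rewrite !mnmE iA; case: (i \in B).
by rewrite !mnmE; case iA: (i \in A) => //; rewrite (AB _ iA).
Qed.

Lemma mesym1_splitI A B : mesym1 A = (mesym1 (A :&: B) + mesym1 (A :\: B))%MM.
Proof.
by apply/mnmP => i; rewrite mnmDE !mnmE !inE; case: (i \in A); case: (i \in B).
Qed.

Lemma square_not_le_mesym1 (i : 'I_n) A : (U_(i) *+ 2 <= mesym1 A)%MM = false.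
Proof.
apply/mnm_lepP => /(_ i); rewrite mulmnE mnm1E mnmE eqxx.
by case: (i \in A).
Qed.

Lemma le_mesym1_sqfree m A : (m <= mesym1 A)%MM -> exists B, m = mesym1 B.
Proof.
move=> /mnm_lepP le; exists [set i | m i != 0%N]; apply/mnmP => i.
by have := le i; rewrite !mnmE inE; case: (i \in A); case: (m i) => // -[].
Qed.

Lemma square_or_sqfree m :
  (exists i, (U_(i) *+ 2 <= m)%MM) \/ (exists B, m = mesym1 B).
Proof.
have [/existsP[i mi]|/existsPn sq] := boolP [exists i, 2 <= m i]%N.
  left; exists i; apply/mnm_lepP => j; rewrite mulmnE mnm1E.
  by case: eqP => [<-|] //; rewrite mul1n.
right; exists [set i | m i != 0%N]; apply/mnmP => i.
by have := sq i; rewrite mnmE inE; case: (m i) => // -[].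
Qed.

End SquarefreeMonomials.

(** * Squarefree coefficients of elements of the ideal *)

Section Coefficients.
Variables (n : nat) (K : fieldType).
Implicit Types (A B T : {set 'I_n}) (m : 'X_{1..n}) (p q : {mpoly K[n]}).

(** Divisors of a squarefree monomial are squarefree, and homogeneity of [q] fixes the degree of the
    cofactor. *)
Lemma mcoeffM_homog d p q B : q \is d.-homog ->
  (p * q)@_(mesym1 B) = \sum_(T in [set T : {set 'I_n} | #|T| + d == #|B|]%N)
     p@_(mesym1 T) * (sqfree_mon K T * q)@_(mesym1 B).
Proof.
move=> qh; elim/mpolyind: p => [|c m p _ _ IH].
  by rewrite mul0r mcoeff0 big1 // => T _; rewrite mcoeff0 mul0r.
rewrite mulrDl mcoeffD {}IH.
under [RHS]eq_bigr => T _ do rewrite mcoeffD mulrDl.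
rewrite big_split /=; congr (_ + _).
rewrite -scalerAl mcoeffZ.
under [RHS]eq_bigr => T _ do rewrite mcoeffZ mcoeffX.
have [/existsP[T /andP[TB /eqP mT]]|/existsPn noT] :=
    boolP [exists T : {set 'I_n}, (#|T| + d == #|B|)%N && (m == mesym1 T)].
  rewrite (bigD1 T) ?inE //= mT eqxx mulr1 big1 ?addr0 // => T' /andP[_ T'T].
  by rewrite (inj_eq (@inj_mesym1 n)) eq_sym (negPf T'T) mulr0 mul0r.
rewrite big1 => [|T]; last first.
  by rewrite inE => TB; have := noT T; rewrite TB /= => /negPf ->; rewrite mulr0 mul0r.
apply/eqP; rewrite mulf_eq0; apply/orP; right; rewrite mulrC.
have [mB|/mcoeffMX_eq0 ->//] := boolP (m <= mesym1 B)%MM.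
have [T mT] := le_mesym1_sqfree mB.
rewrite -(submK mB) addmC mcoeffMX; apply: contraR (noT T) => /negPf nz.
rewrite mT eqxx andbT -!(@mdeg_mesym1 n) -mT -[X in _ == mdeg X](submK mB).
rewrite mdegD addnC eqn_add2r eq_sym; apply: contraFT nz => dne.
by apply/eqP; exact: dhomog_nemf_coeff dne.
Qed.

Lemma dhomog_sum_exp k : (\sum_(i < n) 'X_i : {mpoly K[n]}) ^+ k \is k.-homog.
Proof.
rewrite -[X in X.-homog]mul1n; apply: dhomogMn; apply: rpred_sum => i _.
by rewrite dhomogX; apply/eqP; exact: mdeg1.
Qed.

(** Multiples of squares have no squarefree monomials, so only multiples of the power of the linear
    form count. One [a] serves all [B], which bounds the dimension in each degree. *)
Lemma ideal_I_coeff k p : ideal_I k p -> exists a : {set 'I_n} -> K, forall B,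
  p@_(mesym1 B) = \sum_(T in [set T : {set 'I_n} | #|T| + k == #|B|]%N)
     a T * (sqfree_mon K T * (\sum_(i < n) 'X_i) ^+ k)@_(mesym1 B).
Proof.
case=> s [Is ->]; elim: s Is => [|c s IH] Is.
  by exists (fun=> 0) => B; rewrite big_nil mcoeff0 big1 // => T _; rewrite mul0r.
have [c' c's|a aE] := IH; first by apply: Is; rewrite inE c's orbT.
have [[i c2]|c2] := Is c (mem_head _ _).
  exists a => B; rewrite big_cons mcoeffD -aE c2 mpolyXn mcoeffMX_eq0 ?add0r //.
  by rewrite square_not_le_mesym1.
exists (fun T => c.1@_(mesym1 T) + a T) => B; rewrite big_cons mcoeffD aE c2.
rewrite (mcoeffM_homog _ _ (dhomog_sum_exp k)) -big_split /=.
by apply: eq_bigr => T _; rewrite mulrDl.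
Qed.

End Coefficients.

(** * Admissible orders and the dimension count *)

Section LeadingMonomials.
Variables (n k : nat) (K : fieldType) (le : rel 'X_{1..n}).
Hypothesis leT : term_order le.
Implicit Types (A B : {set 'I_n}) (m : 'X_{1..n}) (p : {mpoly K[n]}).

Lemma term_orderD m1 m2 m3 m4 :
  le m1 m2 -> le m3 m4 -> le (m1 + m3)%MM (m2 + m4)%MM.
Proof.
case: leT => -[_ _ le_trans _] _ leD le12 le34.
by apply: le_trans (leD m3 _ _ le12) _; rewrite !(addmC m2); exact: leD.
Qed.

(** Pair the elements of [A] and [B] arbitrarily and multiply the inequalities. *)
Lemma le_mesym1_dominated A B : #|A| = #|B| ->
  (forall a b, a \in A -> b \in B -> le U_(b)%MM U_(a)%MM) ->
  le (mesym1 B) (mesym1 A).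
Proof.
case: (leT) => -[le_refl _ _ _] _ _.
move cA: #|A| => d; elim: d A B cA => [|d IH] A B cA cB dom.
  by move: (esym cB) cA => /cards0_eq -> /cards0_eq ->.
have /card_gt0P[a aA] : (0 < #|A|)%N by rewrite cA.
have /card_gt0P[b bB] : (0 < #|B|)%N by rewrite -cB.
rewrite (mesym1_splitI A [set a]) (mesym1_splitI B [set b]).
have -> : A :&: [set a] = [set a] by apply/setIidPr; rewrite sub1set.
have -> : B :&: [set b] = [set b] by apply/setIidPr; rewrite sub1set.
rewrite !mesym1_set1; apply: term_orderD; first exact: dom.
apply: IH => [||a' b']; [|move: cB; rewrite (cardsD1 b) bB => -[] //|].
  by move: cA; rewrite (cardsD1 a) aA => -[].
by rewrite !inE => /andP[_ a'A] /andP[_ b'B]; exact: dom.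
Qed.

Lemma lead_mon_square i : lead_mon le ('X_i ^+ 2 : {mpoly K[n]}) = (U_(i) *+ 2)%MM.
Proof.
case: (leT) => -[le_refl _ _ _] _ _.
apply: lead_mon_unique; rewrite // mpolyXn msuppX ?inE // => m.
by rewrite inE => /eqP ->.
Qed.

(** In 0-based terms the swapped indices are [k + 2 * j - 2] and [k + 2 * j - 1], which no cut at
    [k + 2 * r] separates. *)
Lemma special_transposition_below (t : 'S_n) r (i : 'I_n) :
  special_transposition k t -> (t i < k + 2 * r)%N = (i < k + 2 * r)%N.
Proof.
case=> j [a [b [j0 aE bE ->]]].
have ab : (a < k + 2 * r)%N = (b < k + 2 * r)%N by apply/idP/idP; lia.
by case: tpermP => [->|->|].
Qed.

Lemma admissible_perm_below (pi : 'S_n) r (i : 'I_n) :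
  admissible_perm k pi -> (pi i < k + 2 * r)%N = (i < k + 2 * r)%N.
Proof.
case=> sigma [T [sP tT ->]]; rewrite permM.
have -> j : ((\prod_(t in T) t)%g j < k + 2 * r)%N = (j < k + 2 * r)%N.
  elim/big_ind: _ j => [j|s t IHs IHt j|t /tT tk j].
  - by rewrite perm1.
  - by rewrite permM IHt.
  - exact: special_transposition_below.
have [ik|ki] := boolP (i \in [set i : 'I_n | i < k]%N); last by rewrite (out_perm sP ki).
have := perm_closed i sP; rewrite ik; rewrite !inE in ik * => sk.
by rewrite !ltn_addr. 
Qed.

Hypothesis leA : admissible_order k le.

(** The permutation preserves the cut at [k + 2 * r], so variables before it stay larger than those
    after it. *)
Lemma admissible_order_below r (a b : 'I_n) :
  (a < k + 2 * r <= b)%N -> le U_(b)%MM U_(a)%MM.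
Proof.
case/andP=> ar rb; case: leA => _ [pi piA lt].
rewrite -(permKV pi a) -(permKV pi b).
have /lt/andP[//] : ((pi^-1)%g a < (pi^-1)%g b)%N.
apply: (@leq_trans (k + 2 * r)%N).
  by rewrite -(admissible_perm_below _ _ piA) permKV.
by rewrite leqNgt -(admissible_perm_below _ _ piA) permKV -leqNgt.
Qed.

Lemma gvarsE A (i : 'I_n) : (i.+1 + k = 2 * #|A|)%N ->
  gvars k A = A :|: ~: below n i.+1.
Proof.
by move=> iE; apply/setP => j; rewrite !inE -iE ltn_add2r -leqNgt.
Qed.

Lemma gpolyE A : gpoly K k A = esym_on K (gvars k A) #|A|.
Proof. exact: mesym_comp_enum. Qed.

(** Cancel the common variables: what remains of [A] is at most max A, what remains of [B] lies
    beyond it. *)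
Lemma le_gvars A B : A \in famA' n k -> B \subset gvars k A -> #|B| = #|A| ->
  le (mesym1 B) (mesym1 A).
Proof.
case: (leT) => -[le_refl _ _ _] _ _.
move=> /famA'_max[i iA [iE sA _]]; rewrite (gvarsE iE) => sB cB.
rewrite (mesym1_splitI A B) (mesym1_splitI B A) (setIC B A).
apply: term_orderD; first exact: le_refl.
apply: le_mesym1_dominated.
  by apply/eqP; rewrite -(eqn_add2l #|A :&: B|) cardsID setIC cardsID cB.
(* Since max A is [2 * #|A| - k] and at least [#|A|], it is a cut with [r = #|A| - k]. *)
have [r rE] : exists r, i.+1 = (k + 2 * r)%N.
  have cAi := subset_leq_card sA; rewrite card_below // in cAi.
  by exists (#|A| - k)%N; move: cAi iE; move: #|A| => d; lia.
move=> a b; rewrite !inE => /andP[_ /(subsetP sA)]; rewrite inE => ai.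
move=> /andP[bA /(subsetP sB)].
rewrite !inE (negPf bA) /= => bi; apply: (@admissible_order_below r).
by rewrite -rE ai leqNgt.
Qed.

Lemma mcoeff_gpoly A : (gpoly K k A)@_(mesym1 A) = 1.
Proof. by rewrite gpolyE mcoeff_esym_on subsetUl eqxx. Qed.

Lemma lead_mon_gpoly A : A \in famA' n k -> lead_mon le (gpoly K k A) = mesym1 A.
Proof.
move=> fA; apply: lead_mon_unique => //.
  by rewrite mcoeff_msupp mcoeff_gpoly oner_eq0.
move=> m; rewrite gpolyE => /msupp_esym_onP[B /andP[BV /eqP cB] ->].
exact: le_gvars.
Qed.

(** The omitted variables are the down steps before max A. *)
Lemma card_gvarsC A : A \in famA' n k -> (#|~: gvars k A| + k = #|A|)%N.
Proof.
move=> /famA'_max[i iA [iE sA _]]; rewrite (gvarsE iE) setCU setCK.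
have := cardsID A (below n i.+1); rewrite (setIidPr sA) card_below //.
rewrite setIC -setDE; move: #|_ :\: _| #|A| iE => c d; lia.
Qed.

Lemma gpoly_ideal A : [pchar K] =i pred0 -> A \in famA' n k ->
  ideal_I k (gpoly K k A).
Proof.
move=> charK fA; rewrite gpolyE; apply: (@esym_on_ideal _ _ _ _ k) => //.
- by move=> i; left; exists i.
- by right.
- exact: card_gvarsC.
Qed.

(* The squarefree degree-[d] parts of the elements of the ideal lie in the span
   of the multiples [sqfree_mon T * (\sum_i 'X_i) ^+ k], [#|T| + k = d]. The
   multiples of the [gpoly K k A] already provide as many leading monomials as
   there are such [T], so [p] cannot add a new one. *)
Lemma lead_mon_ideal p B : (0 < k)%N -> [pchar K] =i pred0 ->
  ideal_I k p -> p != 0 -> lead_mon le p = mesym1 B -> ~~ avoids k n B.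
Proof.
move=> k0 charK Ip p0 leadp; apply/negP => avB.
have [[le_refl le_anti le_trans le_total] _ leD] := leT.
have [lead_in lead_max] := lead_monP leT p0; rewrite leadp in lead_in lead_max.
set d := #|B|; pose D := B |: [set C : {set 'I_n} | #|C| == d & ~~ avoids k n C].
pose E := [set T : {set 'I_n} | #|T| + k == d]%N.
pose b T C : K := (sqfree_mon K T * (\sum_(i < n) 'X_i) ^+ k)@_(mesym1 C).
have dD C : C \in D -> #|C| = d by rewrite !inE => /orP[/eqP ->|/andP[/eqP]].
(* By reflection at least [#|E|] sets of size [d] reach height [k], and [B] is one more element of
   [D]. *)
have dim : (#|E| < #|D|)%N.
  have dn : (2 * d <= n + k)%N.
    by have := avoidsP _ _ _ avB _ (leqnn n); rewrite below_full setIT => /ltnW.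
  have := card_avoiders k0 (leqnn n) dn.
  have -> : #|D| = #|[set C : {set 'I_n} | #|C| == d & ~~ avoids k n C]|.+1.
    by rewrite cardsU1 inE avB andbF.
  have <- : #|E| = 'C(n, n + k - d).
    have [kd|dk] := leqP k d; last first.
      rewrite bin_small; last by lia.
      by apply: eq_card0 => T; rewrite inE eqn_leq leqNgt ltn_addl.
    have dn' : (d <= n)%N by rewrite -[X in (_ <= X)%N](card_ord n) max_card.
    have -> : #|E| = 'C(n, d - k).
      rewrite -[in RHS](card_ord n) -card_draws; apply: eq_card => T.
      by rewrite !inE -[RHS](eqn_add2r k) subnK.
    by rewrite -bin_sub; [congr 'C(_, _)|]; lia.
  rewrite -[in RHS](card_ord n) -card_draws => cE.
  rewrite ltnS -(leq_add2l #|avoiders n k n d|) cE.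
  rewrite -(cardsID [set C | avoids k n C] [set C : {set 'I_n} | #|C| == d]).
  apply: leq_add; apply: subset_leq_card.
    by apply/subsetP => C; rewrite !inE below_full subsetT.
  by apply/subsetP => C; rewrite !inE andbC.
suff : (#|D| <= #|E|)%N by rewrite leqNgt dim.
have /fin_all_exists[a aP] : forall C : {set 'I_n}, exists a : {set 'I_n} -> K, C \in D ->
    \sum_(T in E) a T * b T C != 0 /\
    {in D, forall C', \sum_(T in E) a T * b T C' != 0 ->
      le (mesym1 C') (mesym1 C)}.
  move=> C; have [CD|_] := boolP (C \in D); last by exists (fun=> 0).
  (* An element of the ideal with leading monomial [mesym1 C]: [p] itself for [B], otherwise a
     monomial multiple of some [gpoly K k A] with [A] inside [C]. *)
  have [q [Iq qC qmax]] : exists q : {mpoly K[n]}, [/\ ideal_I k q,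
      q@_(mesym1 C) != 0 & {in msupp q, forall m, le m (mesym1 C)}].
    move: CD; rewrite !inE => /orP[/eqP ->|/andP[_ navC]].
      by exists p; split; rewrite // -mcoeff_msupp.
    have [A fA] := not_avoids_famA' k0 (leqnn n) navC.
    rewrite below_full setIT => AC.
    have CA : mesym1 C = (mesym1 A + mesym1 (C :\: A))%MM.
      by rewrite (mesym1_splitI C A) (setIidPr AC).
    exists (gpoly K k A * 'X_[mesym1 (C :\: A)]); split.
    - by apply: ideal_genMr; exact: gpoly_ideal.
    - by rewrite CA addmC mcoeffMX mcoeff_gpoly oner_eq0.
    - move=> m /msuppM_le /allpairsP[[m1 m2] /= [m1A]].
      rewrite msuppX inE => /eqP -> ->; rewrite CA; apply: leD.
      move: m1A; rewrite gpolyE => /msupp_esym_onP[B' /andP[BV /eqP cB] ->].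
      exact: le_gvars.
  (* Only squarefree coefficients of degree [d] enter, so [q] may be inhomogeneous. *)
  have [a aE] := ideal_I_coeff Iq; exists a => _.
  have EE C' : C' \in D -> q@_(mesym1 C') = \sum_(T in E) a T * b T C'.
    by move=> /dD dC'; rewrite aE dC'.
  rewrite -EE //; split=> // C' C'D; rewrite -EE // -mcoeff_msupp; exact: qmax.
apply: (@card_triangular_le K _ _ (fun A C => le (mesym1 A) (mesym1 C)) D E
  (fun C C' => \sum_(T in E) a C T * b T C') a b).
- by move=> A; exact: le_refl.
- by move=> A C /le_anti /inj_mesym1.
- by move=> C A C'; exact: le_trans.
- by move=> A C; exact: le_total.
- by [].
- by move=> C /aP[].
- by move=> C C' /aP[_ H] /H.
Qed.

End LeadingMonomials.

(** * The reduced basis *)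

Section ReducedBasis.
Variables (n k : nat) (K : fieldType).
Hypotheses (charK : [pchar K] =i pred0) (k2 : (2 <= k)%N).
Implicit Types (A B : {set 'I_n}) (m : 'X_{1..n}) (g : {mpoly K[n]}).

(** Follows from [#|A|] <= max A <= [n]; it shows that [drange] covers all cardinalities that
    occur. *)
Lemma famA'_bounds A : A \in famA' n k -> (k <= #|A|)%N /\ (2 * #|A| <= n + k)%N.
Proof.
move=> /famA'_max[i iA [iE sA _]].
have := subset_leq_card sA; rewrite card_below // => cA.
by have := ltn_ord i; move: iE cA; move: #|A| => d; lia.
Qed.

Lemma basisGP g : g \in basisG n K k <->
  (exists i, g = 'X_i ^+ 2) \/ (exists2 A, A \in famA n k & g = gpoly K k A).
Proof.
rewrite mem_cat; split=> [/orP[/mapP[i _ ->]|/flatten_mapP[d _ /mapP[A]]]|].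
- by left; exists i.
- by rewrite mem_enum inE => /andP[fA _] ->; right; exists A.
case=> [[i ->]|[A fA ->]]; apply/orP; [left|right].
  by apply: map_f; rewrite mem_enum.
apply/flatten_mapP; exists #|A|; last by apply: map_f; rewrite mem_enum inE fA /=.
have := famA'_bounds (famA_sub_famA' fA); move: #|A| => d [kd dn].
rewrite /drange; case: leqP => nk; last by lia.
by rewrite mem_iota; lia.
Qed.

Variable le : rel 'X_{1..n}.
Hypothesis leA : admissible_order k le.

Let leT : term_order le. Proof. by case: leA. Qed.
Let k0 : (0 < k)%N. Proof. exact: ltnW. Qed.

Lemma lead_mons_basisG m : lead_mons le (basisG n K k) m <->
  (exists i, m = U_(i) *+ 2)%MM \/ (exists2 A, A \in famA n k & m = mesym1 A).
Proof.
split=> [[g /basisGP[[i ->]|[A fA ->]] ->]|[[i ->]|[A fA ->]]].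
- by left; exists i; rewrite lead_mon_square.
- by right; exists A; rewrite // lead_mon_gpoly ?famA_sub_famA'.
- exists ('X_i ^+ 2); last by rewrite lead_mon_square.
  by apply/basisGP; left; exists i.
- exists (gpoly K k A); last by rewrite lead_mon_gpoly ?famA_sub_famA'.
  by apply/basisGP; right; exists A.
Qed.

Lemma basisG_ideal g : g \in basisG n K k -> ideal_I k g /\ g != 0.
Proof.
move=> /basisGP[[i ->]|[A /famA_sub_famA' fA ->]]; split.
- by apply: ideal_gen_in; left; exists i.
- by rewrite mpolyXn -msupp_eq0 msuppX.
- exact: gpoly_ideal.
- apply/eqP => g0; have := mcoeff_gpoly k K A.
  by rewrite g0 mcoeff0 => /eqP; rewrite eq_sym oner_eq0.
Qed.

(** A leading monomial is divisible by a square or squarefree; in the latter case its walk reaches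
    height [k] and so contains a minimal member. *)
Lemma initial_ideal_basisG p :
  initial_ideal le (ideal_I (K := K) k) p <->
  monomial_ideal (lead_mons le (basisG n K k)) p.
Proof.
apply: eq_monomial_ideal => m [].
  move=> f [If f0 ->]; have [[i le2]|[B mB]] := square_or_sqfree (lead_mon le f).
    by exists (U_(i) *+ 2)%MM => //; apply/lead_mons_basisG; left; exists i.
  have navB := lead_mon_ideal leT leA k0 charK If f0 mB.
  have [A fA AB] := not_avoids_famA' k0 (leqnn n) navB.
  have [C fC CA] := famA'_famA fA.
  exists (mesym1 C); first by apply/lead_mons_basisG; right; exists C.
  by rewrite mB mesym1_le (subset_trans CA) // (subset_trans AB) ?subsetIl.
move=> g gG ->; exists (lead_mon le g); last exact: lepm_refl.
by have [Ig g0] := basisG_ideal gG; exists g.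
Qed.

Lemma lead_mons_antichain m m' : lead_mons le (basisG n K k) m ->
  lead_mons le (basisG n K k) m' -> (m' <= m)%MM -> m' = m.
Proof.
move=> /lead_mons_basisG[[i ->]|[A fA ->]] /lead_mons_basisG[[j ->]|[B fB ->]].
- move=> /mnm_lepP/(_ j); rewrite !mulmnE !mnm1E eqxx.
  by case: eqP => // ->.
(* As [#|B|] >= [k] >= 2, two distinct variables would have to divide a power of one. *)
- move=> /mnm_lepP le2; have [kB _] := famA'_bounds (famA_sub_famA' fB).
  have /card_gt1P[a [b [aB bB ab]]] : (1 < #|B|)%N by exact: leq_trans kB.
  have := le2 a; have := le2 b; rewrite !mulmnE !mnm1E !mnmE aB bB.
  case: (i =P b) => [ib|//]; case: (i =P a) => [ia|//].
  by rewrite -ia -ib eqxx in ab.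
- by rewrite square_not_le_mesym1.
- by rewrite mesym1_le => /(famA_antichain fA fB) ->.
Qed.

Lemma lead_mon_basisG_inj : {in basisG n K k &, injective (lead_mon le)}.
Proof.
move=> g h /basisGP[[i ->]|[A /famA_sub_famA' fA ->]]
           /basisGP[[j ->]|[B /famA_sub_famA' fB ->]];
  rewrite ?(lead_mon_square _ leT) ?(lead_mon_gpoly _ leT leA) //.
- move=> /mnmP/(_ i); rewrite !mulmnE !mnm1E eqxx.
  by case: eqP => // ->.
- by move=> E; have := square_not_le_mesym1 i B; rewrite E lepm_refl.
- by move=> E; have := square_not_le_mesym1 j A; rewrite -E lepm_refl.
- by move=> /inj_mesym1 ->.
Qed.

(** If [C] lies in a support set [B] of [gpoly K k A], then [#|C|] <= [#|A|] gives max C <= max A.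
    Outside [A] only indices beyond max A occur in [B], so [C] lies in [A]; minimality yields
    [C = A], hence [B = A]. *)
Lemma basisG_tail g m : g \in basisG n K k -> m \in msupp g ->
  m != lead_mon le g -> ~ initial_ideal le (ideal_I (K := K) k) 'X_[m].
Proof.
move=> /basisGP[[i ->]|[A fA ->]].
  by rewrite lead_mon_square // mpolyXn msuppX inE => ->.
have fA' := famA_sub_famA' fA.
rewrite (lead_mon_gpoly _ leT leA) // gpolyE.
move=> /msupp_esym_onP[B /andP[BV /eqP cB] ->] BA.
move=> /initial_ideal_basisG/monomial_idealX[m' /lead_mons_basisG[[i ->]|[C fC ->]]].
  by rewrite square_not_le_mesym1.
rewrite mesym1_le => CB.
have [i iA [iE sA _]] := famA'_max fA'.
have [j jC [jE sC _]] := famA'_max (famA_sub_famA' fC).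
have CA : C \subset A.
  have cCB := subset_leq_card CB; rewrite cB in cCB.
  have ji : (j.+1 <= i.+1)%N.
    by rewrite -(leq_add2r k) iE jE leq_mul2l.
  apply/subsetP => l lC; have := subsetP BV l (subsetP CB l lC).
  rewrite (gvarsE iE) inE => /orP[//|]; rewrite inE.
  by rewrite (subsetP (sub_below _ ji) _ (subsetP sC _ lC)).
have eCA := famA_antichain fA fC CA; rewrite eCA in CB.
case/eqP: BA; congr mesym1; apply/eqP; rewrite eq_sym eqEcard CB cB.
exact: leqnn.
Qed.

Lemma lead_coeff_basisG g : g \in basisG n K k -> lead_coeff le g = 1.
Proof.
move=> /basisGP[[i ->]|[A /famA_sub_famA' fA ->]]; rewrite /lead_coeff.
  by rewrite lead_mon_square // mpolyXn mcoeffX eqxx.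
by rewrite (lead_mon_gpoly _ leT leA) // mcoeff_gpoly.
Qed.

Lemma reduced_basisG : reduced_groebner_basis le (ideal_I k) (basisG n K k).
Proof.
split; last by move=> g m; exact: basisG_tail.
- by split; [exact: basisG_ideal | exact: initial_ideal_basisG].
- split; first exact: lead_mon_basisG_inj.
  split; first exact: initial_ideal_basisG.
  move=> M' M'G initM' m mG.
  have : initial_ideal le (ideal_I (K := K) k) 'X_[m].
    by apply/initial_ideal_basisG/monomial_idealX; exists m => //; exact: lepm_refl.
  (* Some [m'] in [M'] divides [m], and the antichain property makes them equal. *)
  move=> /initM'/monomial_idealX[m' M'm' le'].
  by rewrite -(lead_mons_antichain mG (M'G _ M'm') le').
- by move=> g; exact: lead_coeff_basisG.
Qed.

Lemma lead_term_gpoly A : A \in famA n k ->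
  lead_term le (gpoly K k A) = \prod_(a in A) 'X_a.
Proof.
move=> /famA_sub_famA' fA; rewrite /lead_term /lead_coeff.
by rewrite (lead_mon_gpoly _ leT leA) // mcoeff_gpoly scale1r -sqfree_monE.
Qed.

End ReducedBasis.

Lemma card_gvars n k (A : {set 'I_n}) : A \in famA' n k ->
  #|gvars k A| = (n - #|A| + k)%N.
Proof.
move=> fA; have := card_gvarsC fA; have := cardsC (gvars k A).
have := max_card (mem A); rewrite card_ord.
move: #|gvars _ _| #|~: _| #|A| => u v d; lia.
Qed.

Theorem theorem2p21 (K : fieldType) (charK : [pchar K] =i pred0)
    (n k : nat) (hn : (1 <= n)%N) (hk : (2 <= k)%N) :
  [/\ forall le : rel 'X_{1..n}, admissible_order k le ->
        reduced_groebner_basis le (ideal_I (n := n) (K := K) k) (basisG n K k) /\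
        (forall A : {set 'I_n}, A \in famA n k ->
           lead_term le (gpoly K k A) = \prod_(a in A) 'X_a),
      forall A : {set 'I_n}, A \in famA n k ->
        #|gvars k A| = (n - #|A| + k)%N /\
        size (msupp (gpoly K k A)) = 'C(n - #|A| + k, #|A|)
    & forall r : nat, (k + 2 * r <= n)%N ->
        #|[set A in famA n k | #|A| == (k + r)%N]|
          = self_convolution k.-1 catalan r].
Proof.
split=> [le leA | A /famA_sub_famA' fA | r kr].
- by split; [exact: reduced_basisG | move=> A; exact: lead_term_gpoly].
- rewrite -(card_gvars fA); split=> //.
  by rewrite gpolyE size_msupp_esym_on.
- have k0 : (0 < k)%N by exact: ltnW.
  by rewrite /self_convolution prednK // series_exp_catalan card_famA.
Qed.
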